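(* Let $p$ be an odd prime and $s>1$ an integer. Let $S\subseteq\mathbb{Z}_2\oplus\mathbb{Z}_p^s$ be $S=\{(1,0,\ldots,0),(0,1,0,\ldots,0),(0,2,0,\ldots,0),\ldots,(0,p-1,0,\ldots,0)\}$. Then the complement of $\mathrm{Cay}(\mathbb{Z}_2\oplus\mathbb{Z}_p^s,S)$ exhibits FR between any vertices $a$ and $b$ with $b-a=(1,0,\ldots,0)$.
   Context: For a finite abelian group $G$ (written additively) and $S\subseteq G\setminus\{0\}$ with $S=-S$, the Cayley graph $\mathrm{Cay}(G,S)$ has vertex set $G$, two distinct vertices $a,b$ being adjacent iff $b-a\in S$; its complement is $\mathrm{Cay}(G,G\setminus(S\cup\{0\}))$. For a graph $\Gamma$ with adjacency matrix $A$, the transition matrix is $H(t)=\exp(-\mathbf{i}tA)$, $t\in\mathbb{R}$, and $\mathbf{e}_v$ is the standard basis vector of vertex $v$. $\Gamma$ exhibits fractional revival (FR) between distinct vertices $a$ and $b$ if there is a positive real $t$ with $H(t)\mathbf{e}_a=\alpha\mathbf{e}_a+\beta\mathbf{e}_b$ for some $\alpha,\beta\in\mathbb{C}$ with $\beta\neq0$ and $|\alpha|^2+|\beta|^2=1$. *)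

(* Defs.v *)
From HB Require Import structures.
From mathcomp Require Import all_boot all_order all_algebra.
From mathcomp Require Import complex.
From mathcomp Require Import all_classical all_reals all_analysis.

Set Implicit Arguments.
Unset Strict Implicit.
Unset Printing Implicit Defensive.

Import Order.TTheory GRing.Theory Num.Theory numFieldNormedType.Exports.
Local Open Scope ring_scope.

(* The usual metric topology on the complex numbers R[i], needed to take limits
   of complex matrices. *)
HB.instance Definition _ (R : rcfType) := NormedModule.copy R[i] R[i]^o.

HB.saturate prod.

(* A simple graph on V is given by its adjacency relation. *)

Definition cayley (G : finZmodType) (S : {set G}) : rel G :=
  fun a b => (a != b) && (b - a \in S).

Definition compl_graph (V : finType) (e : rel V) : rel V :=
  fun a b => (a != b) && ~~ e a b.

Lemma compl_cayley (G : finZmodType) (S : {set G}) :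
  compl_graph (cayley S) =2 cayley (~: (0 |: S)).
Proof.
move=> a b; rewrite /compl_graph /cayley !inE subr_eq0 (eq_sym b a).
by case: eqVneq.
Qed.

(* Rows and columns of matrices are ordinals, so the vertex v is sent to
   enum_rank v : 'I_#|V|. *)

Definition adjmx (R : realType) (V : finType) (e : rel V) : 'M[R[i]]_#|V| :=
  \matrix_(j, k) (e (enum_val j) (enum_val k))%:R.

Definition vertex_vec (R : realType) (V : finType) (v : V) : 'cV[R[i]]_#|V| :=
  delta_mx (enum_rank v) 0.

Definition expmx (R : realType) (n : nat) (A : 'M[R[i]]_n) : 'M[R[i]]_n :=
  limn (series (fun k : nat => (k`!%:R : R[i])^-1 *: A ^+ k)).

Definition transition_mx (R : realType) (V : finType) (e : rel V) (t : R) :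
    'M[R[i]]_#|V| :=
  expmx (- ('i%C * t%:C%C) *: adjmx R e).

Definition fractional_revival (R : realType) (V : finType) (e : rel V)
    (a b : V) : Prop :=
  a != b /\
  exists t : R, 0 < t /\
  exists alpha beta : R[i],
    [/\ transition_mx e t *m vertex_vec R a
          = alpha *: vertex_vec R a + beta *: vertex_vec R b,
        beta != 0
      & `|alpha| ^+ 2 + `|beta| ^+ 2 = 1].

(* (k, 0, ..., 0) in Z_p^s; 'I_s has no canonical zero for a variable s. *)
Definition first_coord (p s : nat) (k : 'Z_p) : 'rV['Z_p]_s :=
  \row_(j < s) (if (j == 0 :> nat)%N then k else 0).

Definition conn_set (p s : nat) : {set 'Z_2 * 'rV['Z_p]_s} :=
  (1, 0) |: [set (0, first_coord s k) | k : 'Z_p & k != 0].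

Lemma conn_set_neq0 (p s : nat) : (0 < s)%N -> 0 \notin conn_set p s.
Proof.
move=> s0; rewrite !inE negb_or; apply/andP; split=> //.
apply/negP => /imsetP[k]; rewrite inE => k0 [] /rowP/(_ (Ordinal s0)).
by rewrite !mxE /= => /esym/eqP; rewrite (negPf k0).
Qed.

Lemma conn_set_opp (p s : nat) (x : 'Z_2 * 'rV['Z_p]_s) :
  (- x \in conn_set p s) = (x \in conn_set p s).
Proof.
suff H y : y \in conn_set p s -> - y \in conn_set p s.
  by apply/idP/idP => /H; rewrite ?opprK.
rewrite !inE => /predU1P[->|/imsetP[k]]; last rewrite inE => k0 ->.
  have N1 : - 1 = 1 :> 'Z_2 by apply: val_inj.
  by rewrite -[- (1, 0)]/(- 1, - 0) oppr0 N1 eqxx.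
apply/orP; right; apply/imsetP; exists (- k); rewrite ?inE ?oppr_eq0 //.
rewrite -[- (0, _)]/(- 0, - first_coord s k) oppr0; congr pair.
by apply/rowP => j; rewrite !mxE; case: ifP; rewrite ?oppr0.
Qed.

(* Main.v *)
(* Write m = (1, 0) and L = {(0, k e_1)}.  The connection set together with 0 is
   m |: L, so the complement has adjacency matrix J - M - Q, where J is the
   all-ones matrix, M the translation by m and Q the sum of the translations by
   L.  These commute, with M^2 = 1, Q^2 = p Q and J^2 = |G| J, so each eigenvalue
   of J - M - Q is congruent to -mu modulo p, mu = 1 or -1 being the eigenvalue
   of M on the same eigenvector.  At t = 2 pi / p the multiples of p disappear
   from the phases and H(t) = exp(i t M) = cos t + i sin t M, where sin t <> 0
   because p > 2. *)

Require Import Defs.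
From HB Require Import structures.
From mathcomp Require Import all_boot all_order all_algebra.
From mathcomp Require Import complex.
From mathcomp Require Import all_classical all_reals all_analysis ring.

Set Implicit Arguments.
Unset Strict Implicit.
Unset Printing Implicit Defensive.

Import Order.TTheory GRing.Theory Num.Theory.
Local Open Scope ring_scope.
Import numFieldNormedType.Exports.

(** * Exponential series of complex matrices and their limits *)

Section MatrixExponential.
Local Open Scope classical_set_scope.

Lemma continuous_real_complex (R : rcfType) :
  continuous (real_complex R : R -> R[i]).
Proof.
(* A positive complex radius has zero imaginary part, so [f] becomes 0. *)
move=> x; apply/cvgrPdist_lt => -[e f] /=; rewrite ltcE /= => /andP[/eqP-> e0].
near=> y; rewrite -rmorphB /= normc_def /= expr0n addr0 sqrtr_sqr ltcR.
by near: y; exact: (@cvgr_dist_lt _ _ _ (nbhs x)).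
Unshelve. all: by end_near. Qed.

(* [cis x] is exp(- i x). *)
Definition cis (R : realType) (x : R) : R[i] :=
  (cos x)%:C%C - 'i%C * (sin x)%:C%C.

(** Since the square of [- 'i] is [-1], the powers split by parity into cosine and sine
    coefficients. *)
Lemma exp_coeff_imag (R : realType) (x : R) (k : nat) :
  (k`!%:R : R[i])^-1 * (- ('i%C * x%:C%C)) ^+ k =
  (cos_coeff x k)%:C%C - 'i%C * (sin_coeff x k)%:C%C.
Proof.
have i2 : (- 'i%C : R[i]) ^+ 2 = -1 by rewrite sqrrN sqr_i.
rewrite /cos_coeff /sin_coeff /= -mulNr exprMn.
rewrite !rmorphM /= !fmorphV /= !rmorphXn /= !rmorphN1 !rmorph_nat.
rewrite -[in (- 'i%C) ^+ k](odd_double_half k) exprD -muln2 mulnC exprM i2.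
case: (boolP (odd k)) => ok /=.
  (* [sin_coeff] has the sign exponent [k.-1./2]. *)
  have -> : k.-1./2 = k./2.
    by rewrite -[in LHS](odd_double_half k) ok /= doubleK.
  by rewrite expr1 !mul0r sub0r !mul1r -!mulNr; ring.
by rewrite expr0 !mul0r mulr0 subr0 !mul1r; ring.
Qed.

Lemma cvg_exp_imag (R : realType) (x : R) :
  series (fun k : nat => (k`!%:R : R[i])^-1 * (- ('i%C * x%:C%C)) ^+ k) @ \oo
    --> cis x.
Proof.
have -> : series (fun k : nat => (k`!%:R : R[i])^-1 * (- ('i%C * x%:C%C)) ^+ k) =
    fun n => (series (cos_coeff x) n)%:C%C - 'i%C * (series (sin_coeff x) n)%:C%C.
  apply/funext => n; rewrite /series /= !rmorph_sum mulr_sumr -sumrB.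
  by apply: eq_bigr => k _; rewrite exp_coeff_imag.
have cvgC (u : R^nat) (l : R) : u @ \oo --> l -> (u n)%:C%C @[n --> \oo] --> l%:C%C.
  by move=> ul; apply: continuous_cvg; first exact: continuous_real_complex.
have cC : series (cos_coeff x) @ \oo --> cos x.
  by rewrite unlock; exact: is_cvg_series_cos_coeff.
have sC : series (sin_coeff x) @ \oo --> sin x.
  by rewrite unlock; exact: is_cvg_series_sin_coeff.
exact: cvgB (cvgC _ _ cC) (cvgMl_tmp (cvgC _ _ sC)).
Qed.

Lemma exprmx_eigen (F : comPzRingType) (n : nat) (B E : 'M[F]_n) (l : F) k :
  B *m E = l *: E -> (B ^+ k) *m E = l ^+ k *: E.
Proof.
move=> BE; elim: k => [|k IH]; first by rewrite !expr0 mul1mx scale1r.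
by rewrite exprSr -mulmxA BE -scalemxAr IH scalerA -exprS.
Qed.

Lemma cvg_expmx_eigen (R : realType) (n : nat) (A E : 'M[R[i]]_n) (t l : R) :
  A *m E = l%:C%C *: E ->
  series (fun k : nat => (k`!%:R : R[i])^-1 *:
    ((- ('i%C * t%:C%C) *: A) ^+ k *m E)) @ \oo --> cis (t * l) *: E.
Proof.
move=> AE; set f := series _.
have -> : f = fun n => series (fun k : nat =>
    (k`!%:R : R[i])^-1 * (- ('i%C * (t * l)%:C%C)) ^+ k) n *: E.
  apply/funext => m; rewrite /f /series /= scaler_suml; apply: eq_bigr => k _.
  rewrite -scalerA -(@exprmx_eigen _ _ (- ('i%C * t%:C%C) *: A)) //.
  by rewrite -scalemxAl AE scalerA rmorphM /= mulrA mulNr.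
apply: cvgZr_tmp; exact: cvg_exp_imag.
Qed.

(** Multiplying each partial sum by the resolution of the identity splits it into finitely many
    scalar exponential series, one per listed eigenvalue. *)
Lemma expmx_spectral (R : realType) (n : nat) (A : 'M[R[i]]_n) (t : R)
    (r : seq (R * 'M[R[i]]_n)) :
  {in r, forall x, A *m x.2 = x.1%:C%C *: x.2} ->
  \sum_(x <- r) x.2 = 1%:M ->
  expmx (- ('i%C * t%:C%C) *: A) = \sum_(x <- r) cis (t * x.1) *: x.2.
Proof.
move=> rA r1; set B := _ *: A; apply: cvg_lim => //.
pose u (x : R * 'M[R[i]]_n) := series (fun k : nat => (k`!%:R : R[i])^-1 *: (B ^+ k *m x.2)).
have -> : series (fun k : nat => (k`!%:R : R[i])^-1 *: B ^+ k) =
    fun m => \sum_(x <- r) u x m.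
  apply/funext => m; rewrite /u /series /= exchange_big /=.
  apply: eq_bigr => k _.
  by rewrite -scaler_sumr -mulmx_sumr r1 mulmx1.
elim: r rA {r1} => [|x r IH] rA.
  by under eq_fun do rewrite big_nil; rewrite big_nil; exact: cvg_cst.
under eq_fun do rewrite big_cons; rewrite big_cons; apply: cvgD.
  by apply: cvg_expmx_eigen; apply: rA; rewrite mem_head.
by apply: IH => y yr; apply: rA; rewrite inE yr orbT.
Qed.

End MatrixExponential.

(** * Spectral decomposition of [J - M - Q] *)

Lemma cis_periodic (R : realType) : periodic (@cis R) (pi *+ 2).
Proof. by move=> x; rewrite /cis cosD2pi sinD2pi. Qed.

Lemma expmx_sub_commuting (R : realType) (n p q : nat) (M Q J : 'M[R[i]]_n) :
    (0 < p)%N -> (0 < q)%N ->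
    M *m M = 1%:M -> Q *m Q = p%:R *: Q -> J *m J = (p * q)%:R *: J ->
    M *m Q = Q *m M -> M *m J = J -> J *m M = J ->
    Q *m J = p%:R *: J -> J *m Q = p%:R *: J ->
  let t : R := 2 * pi / p%:R in
  expmx (- ('i%C * t%:C%C) *: (J - M - Q)) =
    (cos t)%:C%C *: 1%:M + ('i%C * (sin t)%:C%C) *: M.
Proof.
move=> p0 q0 MM QQ JJ MQ MJ JM QJ JQ t.
pose W := M *m Q; pose A := J - M - Q.
have pN0 : p%:R != 0 :> R by rewrite pnatr_eq0 -lt0n.
have pC0 : p%:R != 0 :> R[i] by rewrite pnatr_eq0 -lt0n.
have qC0 : q%:R != 0 :> R[i] by rewrite pnatr_eq0 -lt0n.
(* [A] preserves the span of [1], [M], [Q], [W], [J]; these products reduce the eigenvalue equations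
   to entrywise scalar identities. *)
have AM : A *m M = J - 1%:M - W by rewrite !mulmxBl JM MM -MQ.
have AQ : A *m Q = p%:R *: J - W - p%:R *: Q by rewrite !mulmxBl JQ QQ.
have AW : A *m W = p%:R *: J - Q - p%:R *: W.
  rewrite !mulmxBl !mulmxA JM JQ MM mul1mx; congr (_ - _).
  by rewrite -MQ -mulmxA QQ -scalemxAr.
have AJ : A *m J = (p * q)%:R *: J - J - p%:R *: J by rewrite !mulmxBl JJ MJ QJ.
pose N : R[i] := (p * q)%:R.
(* The joint eigenprojections: on J, and on (M, Q) = (1, p), (-1, p), (1, 0),
   (-1, 0) away from J. *)
rewrite (@expmx_spectral _ _ _ _ [::
  ((p * q)%:R - 1 - p%:R, N^-1 *: J);
  (- 1 - p%:R, (2 * p%:R)^-1 *: (Q + W) - N^-1 *: J);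
  (1 - p%:R, (2 * p%:R)^-1 *: (Q - W));
  (- 1, 2^-1 *: (1%:M + M) - (2 * p%:R)^-1 *: (Q + W));
  (1, 2^-1 *: (1%:M - M) - (2 * p%:R)^-1 *: (Q - W))]).
(* Only the phases [cis (- t)] and [cis t] survive. Their projections add up to [(1 + M) / 2] and
   [(1 - M) / 2], which gives [cos t + i sin t M]. *)
- have tp : t * p%:R = pi *+ 2 by rewrite /t divfK // mulr_natl.
  have cisB x : cis (x - pi *+ 2) = cis x by rewrite -cis_periodic subrK.
  rewrite !big_cons big_nil /= !mulrBr natrM mulrA tp !mulrN !mulr1.
  rewrite !cisB (mulr_natr (pi *+ 2)) (addrC _ (- t)) (periodicn (@cis_periodic R)).
  rewrite /cis cosN sinN; apply/matrixP => i j; rewrite !mxE /=.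
  move: (i == j)%:R (M i j) (Q i j) (J i j) (W i j) => a b c d e.
  rewrite /N natrM rmorphN; field; exact/andP.
- move=> x; rewrite !inE => /or4P[/eqP->|/eqP->|/eqP->|/orP[] /eqP->] /=;
    rewrite -/A ?(mulmxDr, mulmxBr, =^~scalemxAr, mulmxN) ?(AM, AQ, AW, AJ, mulmx1);
    apply/matrixP => i j; rewrite !mxE /N;
    rewrite ?(rmorphB, rmorphN, rmorph_nat, rmorph1) ?natrM; field;
    by rewrite ?pC0 ?qC0.
- rewrite !big_cons big_nil /=; apply/matrixP => i j; rewrite !mxE.
  by field; rewrite ?pC0.
Qed.

(** * Translation matrices of a finite abelian group *)

(** The sum of the permutation matrices of the translations by [D]; the choices [[set m]], [L] and
    [[set: G]] yield [M], [Q] and [J]. *)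
Definition transl_mx (F : comPzRingType) (G : finZmodType) (D : {set G}) :
    'M[F]_#|G| :=
  \matrix_(j, k) (enum_val k - enum_val j \in D)%:R.

Section TranslMx.
Variables (F : comPzRingType) (G : finZmodType).
Local Notation T := (@transl_mx F G).
Implicit Types D E : {set G}.

Lemma transl_mxM D E :
  T D *m T E = \matrix_(j, k) \sum_(d in D)
                  (enum_val k - enum_val j - d \in E)%:R.
Proof.
apply/matrixP => j k; rewrite !mxE [RHS]big_mkcond /=.
(* The middle vertex of a two-step walk from [j] is indexed by its first step [d]. *)
rewrite (reindex (fun d : G => enum_rank (d + enum_val j))) /=; last first.
  exists (fun l => enum_val l - enum_val j) => l _.
    by rewrite enum_rankK addrK.
  by rewrite subrK enum_valK.
apply: eq_bigr => d _; rewrite !mxE enum_rankK addrK opprD addrA addrAC.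
by case: (d \in D); rewrite ?mul1r ?mul0r.
Qed.

(** The reflection of the middle vertex [l] to [j + k - l] swaps the two steps of a walk from [j] to
    [k]. *)
Lemma transl_mxC D E : T D *m T E = T E *m T D.
Proof.
apply/matrixP => j k; rewrite !mxE.
pose h (l : 'I_#|G|) : 'I_#|G| := enum_rank (enum_val j + enum_val k - enum_val l).
have hK : involutive h.
  by move=> l; rewrite /h enum_rankK opprB addrCA subrr addr0 enum_valK.
rewrite (reindex h) /=; last by exists h => l _; rewrite hK.
apply: eq_bigr => l _; rewrite !mxE enum_rankK mulrC opprB.
rewrite [_ + _ - _ - _]addrAC [_ + _ - enum_val j]addrAC subrr add0r.
by rewrite opprD (addrC (- enum_val j)) addrCA addNKr.
Qed.

(** Each translation by [D] fixes [T E]. This one fact gives the products [QQ], [JJ], [MJ] and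
    [QJ]. *)
Lemma transl_mx_absorb D E :
    {in D, forall d x, (x - d \in E) = (x \in E)} ->
  T D *m T E = #|D|%:R *: T E.
Proof.
move=> DEinv; rewrite transl_mxM; apply/matrixP => j k; rewrite !mxE.
under eq_bigr => d dD do rewrite DEinv //.
by rewrite sumr_const mulr_natl.
Qed.

Lemma transl_mx0 : T [set 0] = 1%:M.
Proof.
apply/matrixP => j k; rewrite !mxE inE subr_eq0 (inj_eq enum_val_inj).
by rewrite eq_sym.
Qed.

Lemma transl_mx_set1M x y : T [set x] *m T [set y] = T [set x + y].
Proof.
rewrite transl_mxM; apply/matrixP => j k; rewrite !mxE big_set1 !inE.
by rewrite subr_eq (addrC y).
Qed.

End TranslMx.

Lemma transl_mx_vertex_vec (R : realType) (G : finZmodType) (x a : G) :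
  transl_mx R[i] [set x] *m vertex_vec R a = vertex_vec R (a - x).
Proof.
apply/colP => j; rewrite /vertex_vec -colE !mxE enum_rankK inE andbT.
rewrite -(inj_eq enum_val_inj) enum_rankK subr_eq eq_sym addrC eq_sym.
by rewrite [in RHS]eq_sym subr_eq.
Qed.

(** Here [L] is a subgroup of index [q] and [m] an involution outside it. *)
Lemma transition_mx_cocayley (R : realType) (G : finZmodType) (m : G)
    (L : {set G}) (q : nat) :
    m + m = 0 -> m \notin L -> 0 \in L -> {in L &, forall x y, x - y \in L} ->
    #|G| = (#|L| * q)%N ->
  let t : R := 2 * pi / #|L|%:R in
  transition_mx [rel a b : G | b - a \notin m |: L] t =
    (cos t)%:C%C *: 1%:M + ('i%C * (sin t)%:C%C) *: transl_mx R[i] [set m].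
Proof.
move=> mm mL L0 LB cG t; pose T := @transl_mx R[i] G.
have LDr x : x \in L -> forall y, (y - x \in L) = (y \in L).
  move=> xL y; apply/idP/idP => [yxL|yL]; last exact: LB.
  have /(LB _ _ yxL) : - x \in L by rewrite -sub0r; exact: LB.
  by rewrite opprK subrK.
have p0 : (0 < #|L|)%N by apply/card_gt0P; exists 0.
have q0 : (0 < q)%N.
  have : (0 < #|G|)%N by apply/card_gt0P; exists 0.
  by rewrite cG muln_gt0 => /andP[].
have -> : transition_mx [rel a b : G | b - a \notin m |: L] t =
    expmx (- ('i%C * t%:C%C) *: (T [set: G] - T [set m] - T L)).
  congr (expmx (_ *: _)); apply/matrixP => j k; rewrite !mxE /=.
  (* As [m] is not in [L], at most one of the two subtracted entries is 1. *)
  rewrite !inE; have [->|_] := eqVneq.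
    by rewrite (negPf mL) subrr subr0.
  by rewrite subr0; case: (_ \in L); rewrite ?subrr ?subr0.
apply: (expmx_sub_commuting p0 q0).
- by rewrite transl_mx_set1M mm transl_mx0.
- by rewrite transl_mx_absorb.
- by rewrite transl_mx_absorb -?cG ?cardsT // => ? ? ?; rewrite !inE.
- exact: transl_mxC.
- by rewrite transl_mx_absorb ?cards1 ?scale1r // => ? ? ?; rewrite !inE.
- rewrite transl_mxC.
  by rewrite transl_mx_absorb ?cards1 ?scale1r // => ? ? ?; rewrite !inE.
- by rewrite transl_mx_absorb // => ? ? ?; rewrite !inE.
- by rewrite transl_mxC transl_mx_absorb // => ? ? ?; rewrite !inE.
Qed.

Theorem theorem5p4 (R : realType) (p s : nat) (p_prime : prime p)
    (p_odd : odd p) (s_gt1 : (1 < s)%N) (a b : 'Z_2 * 'rV['Z_p]_s)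
    (hab : b - a = (1, 0)) :
  fractional_revival R (compl_graph (cayley (conn_set p s))) a b.
Proof.
pose G : finZmodType := ('Z_2 * 'rV['Z_p]_s)%type.
pose m : G := (1, 0).
pose L : {set G} := [set (0, first_coord s k) | k : 'Z_p].
have p_gt1 := prime_gt1 p_prime.
have p_gt2 : (2 < p)%N by rewrite odd_prime_gt2.
have cardZp : #|{: 'Z_p}| = p by rewrite card_ord Zp_cast.
have cardL : #|L| = p.
  rewrite card_imset // => k l [] /rowP/(_ (Ordinal (ltnW s_gt1))).
  by rewrite !mxE.
(* The index of the line [L] in [G]. *)
have cardG : #|G| = (#|L| * (2 * p ^ s.-1))%N.
  rewrite cardL card_prod card_mx card_ord mul1n cardZp.
  by rewrite -[in LHS](prednK (ltnW s_gt1)) expnS mulnCA.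
have mm : m + m = 0 by congr pair; [exact: val_inj | rewrite addr0].
have mL : m \notin L by apply/imsetP => -[k _ []].
have L0 : 0 \in L.
  apply/imsetP; exists 0 => //; congr pair.
  by apply/rowP => j; rewrite !mxE if_same.
have LB : {in L &, forall x y, x - y \in L}.
  move=> _ _ /imsetP[k _ ->] /imsetP[l _ ->]; apply/imsetP.
  exists (k - l) => //; congr pair; first by rewrite subr0.
  by apply/rowP => j; rewrite !mxE; case: ifP => // _; rewrite subr0.
(* Putting 0 into the line absorbs the condition that adjacent vertices differ. *)
have He : compl_graph (cayley (conn_set p s)) =
    [rel a b : G | b - a \notin m |: L].
  apply/funext => x; apply/funext => y; rewrite compl_cayley /cayley /=.
  rewrite -subr_eq0 -(oppr_eq0 (x - y)) opprB; set z := y - x.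
  rewrite !inE !negb_or; case: eqVneq => [->|zN0] /=.
    by rewrite L0.
  congr (_ && ~~ _); apply/imsetP/imsetP => -[k kN0 zE]; exists k => //.
  rewrite inE; apply: contra_neq zN0 => k0; rewrite zE k0; congr pair.
  by apply/rowP => j; rewrite !mxE if_same.
have p_gt0 : 0 < p%:R :> R by rewrite ltr0n prime_gt0.
pose t : R := 2 * pi / p%:R.
have t_gt0 : 0 < t by rewrite divr_gt0 // mulr_gt0 // pi_gt0.
have t_ltpi : t < pi.
  by rewrite ltr_pdivrMr // mulrC ltr_pM2l ?pi_gt0 // ltr_nat.
(* The translation matrix of [m] sends the vector of [a] to that of [a - m], which is [b] because
   [m = - m]. *)
have bE : b = a - m.
  by rewrite -(subrK a b) hab addrC -[in RHS](addrK m a) -!addrA -opprD mm subr0.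
split; first by rewrite eq_sym -subr_eq0 hab.
exists t; split=> //; exists (cos t)%:C%C, ('i%C * (sin t)%:C%C); split.
- have := transition_mx_cocayley R mm mL L0 LB cardG.
  rewrite He cardL => /= ->.
  by rewrite mulmxDl -!scalemxAl mul1mx transl_mx_vertex_vec bE.
- rewrite mulf_neq0 //; first by rewrite eq_complex /= oner_eq0 andbF.
  by rewrite eq_complex /= eqxx andbT gt_eqF // sin_gt0_pi // t_gt0.
- rewrite normrM !normc_def /= !expr0n /= !addr0 add0r expr1n !sqrtr_sqr sqrtr1.
  by rewrite mul1r -!rmorphXn /= !real_normK ?num_real // -rmorphD /= cos2Dsin2.
Qed.
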